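(* Let $\mathbb F$ be a field of characteristic $0$, let $C=Cend_{1,x}$ be the associative conformal algebra over $\mathbb F$ described in the context, and let $M$ be an arbitrary conformal bimodule over $C$. Then the second Hochschild cohomology group vanishes: $H^2(C,M)=0$. That is, every $2$-cocycle $\varphi\in Z^2(C,M)$ is a $2$-coboundary, $\varphi=\delta_1\tau$ for some $1$-cochain $\tau: C\to M$.
   Context: Let $\mathbb F$ be a field of characteristic $0$, $H=\mathbb F[D]$ the polynomial algebra, $\mathbb Z_+$ the non-negative integers. In all formulas below terms with coefficient $0$ are read as $0$, and $\binom{n}{s}=0$ for $s>n$. A conformal algebra is a left $H$-module $A$ with $\mathbb F$-linear maps $\circ_n: A\otimes A\to A$, $n\in\mathbb Z_+$, such that for all $a,b\in A$, $n\in\mathbb Z_+$: (1) $a\circ_n b=0$ for all sufficiently large $n$ (depending on $a,b$); (2) $Da\circ_n b=-n\,a\circ_{n-1}b$; (3) $a\circ_n Db=D(a\circ_n b)+n\,a\circ_{n-1}b$. It is associative if $(a\circ_n b)\circ_m c=\sum_{s\ge0}(-1)^s\binom{n}{s}a\circ_{n-s}(b\circ_{m+s}c)$ for all $a,b,c\in A$, $m,n\in\mathbb Z_+$. The algebra $Cend_{1,x}$: it is the conformal subalgebra $x\,\mathbb F[D,x]$ of $Cend_1=\mathbb F[D,x]$; it is the free $H$-module with basis $x^k$, $k\ge1$, and its operations are determined by (2), (3) and $x^k\circ_n x^l=x^k\,\frac{d^n}{dx^n}(x^l)=n!\binom{l}{n}x^{k+l-n}$ for $k,l\ge1$, $n\in\mathbb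 Z_+$. A left module over an associative conformal algebra $A$ is a left $H$-module $V$ with $\mathbb F$-linear maps $\circ_n: A\otimes V\to V$, $n\in\mathbb Z_+$, such that for $a,b\in A$, $v\in V$: $a\circ_n v=0$ for sufficiently large $n$; $Da\circ_n v=-n\,a\circ_{n-1}v$; $a\circ_n Dv=D(a\circ_n v)+n\,a\circ_{n-1}v$; $(a\circ_m b)\circ_n v=\sum_{s\ge0}(-1)^s\binom{m}{s}a\circ_{m-s}(b\circ_{n+s}v)$. A right module is defined similarly by maps $\circ_n: V\otimes A\to V$ with $v\circ_n a=0$ for sufficiently large $n$; $Dv\circ_n a=-n\,v\circ_{n-1}a$; $v\circ_n Da=D(v\circ_n a)+n\,v\circ_{n-1}a$; $(v\circ_m a)\circ_n b=\sum_{s\ge0}(-1)^s\binom{m}{s}v\circ_{m-s}(a\circ_{n+s}b)$. A (conformal) bimodule is simultaneously a left and a right module (same $H$-module structure) with $(a\circ_m v)\circ_n b=\sum_{s\ge0}(-1)^s\binom{m}{s}a\circ_{m-s}(v\circ_{n+s}b)$. Let $V$ be an $A$-bimodule. A $1$-cochain is an $H$-linear map $\tau:A\to V$. A $2$-cochain $\varphi$ is a family of $\mathbb F$-bilinear maps $\varphi_s:A\times A\to V$, $s\in\mathbb Z_+$, such that $\varphi_s(Da,b)=-s\varphi_{s-1}(a,b)$, $\varphi_s(a,Db)=D\varphi_s(a,b)+s\varphi_{s-1}(a,b)$, and for all $a,b$ one has $\varphi_s(a,b)=0$ for sufficiently large $s$. The differentials are $(\delta_1\tau)_n(a,b)=a\circ_n\tau(b)-\tau(a\circ_n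 b)+\tau(a)\circ_n b$, $(\delta_2\varphi)_{mn}(a,b,c)=a\circ_m\varphi_n(b,c)+\varphi_m(a,b\circ_n c)-\sum_{s\ge0}\binom{m}{s}\big(\varphi_{n+s}(a\circ_{m-s}b,c)+\varphi_{m-s}(a,b)\circ_{n+s}c\big)$ for $a,b,c\in A$, $m,n\in\mathbb Z_+$. A $2$-cocycle is a $2$-cochain with $\delta_2\varphi=0$ (all $m,n,a,b,c$); a $2$-coboundary is a $2$-cochain of the form $\delta_1\tau$. $Z^2(A,V)$ and $B^2(A,V)$ are the spaces of $2$-cocycles and $2$-coboundaries, and $H^2(A,V)=Z^2(A,V)/B^2(A,V)$. *)

(* Defs.v *)
From HB Require Import structures.
From mathcomp Require Import all_boot all_algebra.

Set Implicit Arguments.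
Unset Strict Implicit.
Unset Printing Implicit Defensive.

Import GRing.Theory.
Local Open Scope ring_scope.

(* An H-module, H = F[D], is an [lmodType {poly F}]: D acts as
   ['X *: _] and a scalar c of F as [c%:P *: _]. *)

(* The axioms shared by the operations of a conformal algebra, the left and
   right actions on a conformal module, and 2-cochains. For n = 0 the junk
   value f n.-1 is multiplied by 0. *)
Record conformal_map (F : fieldType) (A B V : lmodType {poly F})
    (f : nat -> A -> B -> V) : Prop := ConformalMap {
  cmap_linearl : forall n (c : F) a a' b,
    f n (c%:P *: a + a') b = c%:P *: f n a b + f n a' b;
  cmap_linearr : forall n (c : F) a b b',
    f n a (c%:P *: b + b') = c%:P *: f n a b + f n a b';
  cmap_locality : forall a b, exists N : nat, forall n, (N <= n)%N ->
    f n a b = 0;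
  cmap_Dl : forall n a b, f n ('X *: a) b = - (f n.-1 a b *+ n);
  cmap_Dr : forall n a b,
    f n a ('X *: b) = 'X *: f n a b + f n.-1 a b *+ n
}.

(* (a o_n b) o_m c = \sum_s (-1)^s C(n,s) a o_(n-s) (b o_(m+s) c), where each of
   the four products may be an algebra product or a module action. *)
Definition conformal_assoc (F : fieldType) (A B C AB BC V : lmodType {poly F})
    (opAB : nat -> A -> B -> AB) (opABC : nat -> AB -> C -> V)
    (opBC : nat -> B -> C -> BC) (opA_BC : nat -> A -> BC -> V) : Prop :=
  forall (n m : nat) (a : A) (b : B) (c : C),
    opABC m (opAB n a b) c =
    \sum_(s < n.+1)
      (-1) ^+ s *: (opA_BC (n - s)%N a (opBC (m + s)%N b c) *+ 'C(n, s)).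

Record assoc_conformal_algebra (F : fieldType) (A : lmodType {poly F})
    (op : nat -> A -> A -> A) : Prop := AssocConformalAlgebra {
  aca_conformal : conformal_map op;
  aca_assoc : conformal_assoc op op op op
}.

Record conformal_bimodule (F : fieldType) (A M : lmodType {poly F})
    (op : nat -> A -> A -> A) (lact : nat -> A -> M -> M)
    (ract : nat -> M -> A -> M) : Prop := ConformalBimodule {
  cbim_left : conformal_map lact;
  cbim_left_assoc : conformal_assoc op lact lact lact;
  cbim_right : conformal_map ract;
  cbim_right_assoc : conformal_assoc ract ract op ract;
  cbim_assoc : conformal_assoc lact ract ract lact
}.

Definition delta1 (F : fieldType) (A M : lmodType {poly F})
    (op : nat -> A -> A -> A) (lact : nat -> A -> M -> M)
    (ract : nat -> M -> A -> M) (tau : A -> M) (n : nat) (a b : A) : M :=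
  lact n a (tau b) - tau (op n a b) + ract n (tau a) b.

Definition delta2 (F : fieldType) (A M : lmodType {poly F})
    (op : nat -> A -> A -> A) (lact : nat -> A -> M -> M)
    (ract : nat -> M -> A -> M) (phi : nat -> A -> A -> M)
    (m n : nat) (a b c : A) : M :=
  lact m a (phi n b c) + phi m a (op n b c)
  - \sum_(s < m.+1)
      (phi (n + s)%N (op (m - s)%N a b) c
       + ract (n + s)%N (phi (m - s)%N a b) c) *+ 'C(m, s).

Definition cocycle2 (F : fieldType) (A M : lmodType {poly F})
    (op : nat -> A -> A -> A) (lact : nat -> A -> M -> M)
    (ract : nat -> M -> A -> M) (phi : nat -> A -> A -> M) : Prop :=
  conformal_map phi /\
  forall m n a b c, delta2 op lact ract phi m n a b c = 0.

Definition coboundary2 (F : fieldType) (A M : lmodType {poly F})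
    (op : nat -> A -> A -> A) (lact : nat -> A -> M -> M)
    (ract : nat -> M -> A -> M) (phi : nat -> A -> A -> M) : Prop :=
  conformal_map phi /\
  exists tau : {linear A -> M},
    forall n a b, phi n a b = delta1 op lact ract tau n a b.

(* Cend_1 = F[D,x] is {poly {poly F}}: the outer variable is x, the inner one
   is D, so that {poly F} = F[D] acts by scaling. *)

Definition Dcoef (F : fieldType) (i : nat) (a : {poly {poly F}}) :
    {poly {poly F}} := map_poly (polyC \o coefp i) a.

(* d/dD + d/dx *)
Definition partial (F : fieldType) (a : {poly {poly F}}) : {poly {poly F}} :=
  map_poly (@deriv F) a + a^`().

(* In terms of the lambda-product \sum_n (lambda^n / n!) (a o_n b), the products
   x^k o_n x^l = x^k (d/dx)^n x^l together with the two sesquilinearity axioms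
   amount to a(D,x) o_lambda b(D,x) = a(-lambda,x) b(D+lambda,x+lambda), and
   b(D+lambda,x+lambda) = exp(lambda (d/dD + d/dx)) b.  Below is n! times its
   coefficient at lambda^n; see cend1_opXn, cend1_opDl and cend1_opDr. *)
Definition cend1_op (F : fieldType) (n : nat) (a b : {poly {poly F}}) :
    {poly {poly F}} :=
  \sum_(i < n.+1)
    (-1) ^+ i *: (Dcoef i a * iter (n - i) (@partial F) b *+ n ^_ i).

Section Cend1.
Context (F : fieldType).
Local Notation R := {poly {poly F}}.
Local Notation d := (@partial F).
Local Notation D := ('X : {poly F}).
Implicit Types (a b c : R).

Lemma cend1_ind (P : R -> Prop) :
  (forall a b, P a -> P b -> P (a + b)) -> (forall c : F, P c%:P%:P) ->
  (forall a, P a -> P (D *: a)) -> (forall a, P a -> P (a * 'X)) ->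
  forall a, P a.
Proof.
move=> PD PC PsD Px a; elim/poly_ind: a => [|a p IH].
  by have := PC 0; rewrite !polyC0.
apply: (PD); first exact: Px.
elim/poly_ind: p => [|p c IHp]; first by rewrite -polyC0; exact: PC.
rewrite polyCD; apply: PD => //.
by rewrite mulrC polyCM mul_polyC; exact: PsD.
Qed.

Lemma partialD a b : d (a + b) = d a + d b.
Proof. by rewrite /partial derivD raddfD /= addrACA. Qed.

Lemma partialZ (c : F) a : d (c%:P *: a) = c%:P *: d a.
Proof.
rewrite /partial derivZ scalerDr; congr (_ + _); apply/polyP=> i.
by rewrite coefZ !coef_map_id0 ?coefZ ?linear0 // !mul_polyC derivZ.
Qed.

Lemma partial_D a : d (D *: a) = a + D *: d a.
Proof.
rewrite /partial derivZ scalerDr addrA; congr (_ + _); apply/polyP=> i.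
rewrite coefD coefZ !coef_map_id0 ?coefZ ?linear0 //.
by rewrite derivM derivX mul1r.
Qed.

Lemma partial_x a : d (a * 'X) = a + d a * 'X.
Proof.
rewrite /partial derivM derivX mulr1 mulrDl addrC addrAC addrC; congr (_ + _).
rewrite addrC; congr (_ + _); apply/polyP=> i.
rewrite coefMX !coef_map_id0 ?linear0 // coefMX.
by case: i => [|i]; rewrite /= ?linear0 // coef_map_id0 ?linear0.
Qed.

Lemma partialC (c : F) : d c%:P%:P = 0.
Proof. by rewrite /partial derivC addr0 map_polyC /= derivC. Qed.

Lemma iter_partialD n a b : iter n d (a + b) = iter n d a + iter n d b.
Proof. by elim: n => //= n ->; rewrite partialD. Qed.

Lemma iter_partialZ n (c : F) a : iter n d (c%:P *: a) = c%:P *: iter n d a.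
Proof. by elim: n => //= n ->; rewrite partialZ. Qed.

Lemma iter_partial0 n : iter n d 0 = 0.
Proof. by elim: n => //= n ->; rewrite /partial raddf0 deriv0 addr0. Qed.

Lemma iter_partialMn n a k : iter n d (a *+ k) = iter n d a *+ k.
Proof.
by elim: k => [|k IH]; rewrite ?mulr0n ?iter_partial0 // !mulrS iter_partialD IH.
Qed.

Lemma partialMn a k : d (a *+ k) = d a *+ k.
Proof. exact: (iter_partialMn 1). Qed.

Lemma partialN a : d (- a) = - d a.
Proof. by apply: (addrI (d a)); rewrite -partialD !subrr; exact: (iter_partial0 1). Qed.

Lemma partial_iter_pred n a : d (iter n.-1 d a *+ n) = iter n d a *+ n.
Proof. by rewrite partialMn; case: n. Qed.

Lemma iter_partial_D n a :
  iter n d (D *: a) = D *: iter n d a + iter n.-1 d a *+ n.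
Proof.
elim: n => [|n IH]; first by rewrite mulr0n addr0.
rewrite iterS IH partialD partial_D partial_iter_pred /=.
by rewrite [in RHS]mulrS [in RHS]addrCA addrA.
Qed.

Lemma iter_partial_x n a :
  iter n d (a * 'X) = iter n d a * 'X + iter n.-1 d a *+ n.
Proof.
elim: n => [|n IH]; first by rewrite mulr0n addr0.
rewrite iterS IH partialD partial_x partial_iter_pred /=.
by rewrite [in RHS]mulrS [in RHS]addrCA addrA.
Qed.

Lemma DcoefD i a b : Dcoef i (a + b) = Dcoef i a + Dcoef i b.
Proof. by rewrite /Dcoef raddfD. Qed.

Lemma coef_Dcoef i a j : (Dcoef i a)`_j = (a`_j`_i)%:P.
Proof. by rewrite coef_map_id0 //= coefE polyC0. Qed.

Lemma DcoefZ i (c : F) a : Dcoef i (c%:P *: a) = c%:P *: Dcoef i a.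
Proof. by apply/polyP=> j; rewrite coefZ !coef_Dcoef coefZ coefCM polyCM. Qed.

Lemma Dcoef_x i a : Dcoef i (a * 'X) = Dcoef i a * 'X.
Proof.
apply/polyP=> j; rewrite coef_Dcoef !coefMX.
by case: j => [|j]; rewrite /= ?coef0 ?polyC0 ?coef_Dcoef.
Qed.

Lemma Dcoef_D i a : Dcoef i (D *: a) = if i is j.+1 then Dcoef j a else 0.
Proof.
apply/polyP=> j; rewrite coef_Dcoef coefZ coefXM.
by case: i => [|i] /=; rewrite ?coef0 ?coef_Dcoef ?polyC0.
Qed.

Lemma Dcoef_C i (c : F) : Dcoef i c%:P%:P = if i == 0%N then c%:P%:P else 0.
Proof.
apply/polyP=> j; rewrite coef_Dcoef coefC; case: eqP => [->|/eqP jn0].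
  by rewrite coefC; case: eqP; rewrite ?coefC ?coef0 ?polyC0.
by rewrite coef0; case: eqP; rewrite ?coefC ?(negPf jn0) ?coef0 ?polyC0.
Qed.

Lemma cend1_op_linearl n (c : F) a a' b :
  cend1_op n (c%:P *: a + a') b = c%:P *: cend1_op n a b + cend1_op n a' b.
Proof.
rewrite /cend1_op scaler_sumr -big_split /=; apply: eq_bigr => i _.
rewrite DcoefD DcoefZ mulrDl mulrnDl scalerDr; congr (_ + _).
by rewrite -scalerAl scalerMnr !scalerA [_ * (-1) ^+ _]mulrC.
Qed.

Lemma cend1_op_linearr n (c : F) a b b' :
  cend1_op n a (c%:P *: b + b') = c%:P *: cend1_op n a b + cend1_op n a b'.
Proof.
rewrite /cend1_op scaler_sumr -big_split /=; apply: eq_bigr => i _.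
rewrite iter_partialD iter_partialZ mulrDr mulrnDl scalerDr; congr (_ + _).
by rewrite -scalerAr scalerMnr !scalerA [_ * (-1) ^+ _]mulrC.
Qed.

Lemma cend1_opDl n a b :
  cend1_op n (D *: a) b = - (cend1_op n.-1 a b *+ n).
Proof.
rewrite /cend1_op big_ord_recl /= Dcoef_D mul0r mul0rn scaler0 add0r.
case: n => [|n]; first by rewrite big_ord0 mulr0n oppr0.
rewrite /= -sumrMnl -sumrN; apply: eq_bigr => i _.
rewrite Dcoef_D /bump /= !add1n subSS ffactnS exprS mulN1r scaleNr; congr (- _).
by rewrite mulnC mulrnA scalerMnr.
Qed.

Lemma cend1_opDr n a b :
  cend1_op n a (D *: b) = D *: cend1_op n a b + cend1_op n.-1 a b *+ n.
Proof.
have -> : cend1_op n.-1 a b *+ n = \sum_(i < n.+1) (-1) ^+ i *: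
    (Dcoef i a * iter (n - i).-1 d b *+ (n - i) *+ n ^_ i).
  rewrite big_ord_recr /= subnn mulr0n mul0rn scaler0 addr0.
  case: n => [|n]; first by rewrite big_ord0 mulr0n.
  rewrite /cend1_op /= -sumrMnl; apply: eq_bigr => i _.
  have le_in : (i <= n)%N by rewrite -ltnS ltn_ord.
  rewrite subSn //= -subSn // -mulrnA mulnC -ffactnSr ffactnS /=.
  by rewrite mulnC mulrnA scalerMnr.
rewrite /cend1_op scaler_sumr -big_split /=; apply: eq_bigr => i _.
rewrite iter_partial_D mulrDr mulrnAr mulrnDl scalerDr; congr (_ + _).
by rewrite -scalerAr scalerMnr !scalerA [_ * (-1) ^+ _]mulrC.
Qed.

Lemma cend1_opx n a b : cend1_op n (a * 'X) b = cend1_op n a b * 'X.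
Proof.
rewrite /cend1_op mulr_suml; apply: eq_bigr => i _.
by rewrite Dcoef_x -scalerAl mulrnAl mulrAC.
Qed.

Lemma cend1_opC n (c : F) b : cend1_op n c%:P%:P b = c%:P *: iter n d b.
Proof.
rewrite /cend1_op big_ord_recl /= big1 => [|i _].
  by rewrite Dcoef_C eqxx addr0 expr0 scale1r subn0 ffactn0 mulr1n mul_polyC.
by rewrite Dcoef_C /= mul0r mul0rn scaler0.
Qed.

Lemma cend1_opDdl n a a' b :
  cend1_op n (a + a') b = cend1_op n a b + cend1_op n a' b.
Proof. by rewrite -[a in LHS]scale1r -polyC1 cend1_op_linearl polyC1 scale1r. Qed.

Lemma cend1_opZl n (c : F) a b :
  cend1_op n (c%:P *: a) b = c%:P *: cend1_op n a b.
Proof.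
have op0 : cend1_op n 0 b = 0 by rewrite -polyC0 -polyC0 cend1_opC scale0r.
by rewrite -[c%:P *: a]addr0 cend1_op_linearl op0 addr0.
Qed.

Lemma cend1_op0l n b : cend1_op n 0 b = 0.
Proof. by rewrite -[0 in LHS]/(0 : R) -!polyC0 cend1_opC polyC0 scale0r. Qed.

Lemma cend1_opNMl n a b k :
  cend1_op n (- (a *+ k)) b = - (cend1_op n a b *+ k).
Proof.
have E (v : R) : - (v *+ k) = (- k%:R : F)%:P *: v.
  by rewrite polyCN scaleNr polyCMn scaler_nat.
by rewrite !E cend1_opZl.
Qed.

Lemma partial_op n a b :
  d (cend1_op n a b) = cend1_op n (d a) b + cend1_op n.+1 a b.
Proof.
move: n; elim/cend1_ind: a => [a a' IH IH'|c|a IH|a IH] n.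
- by rewrite (partialD a) !(cend1_opDdl _ a) (cend1_opDdl _ (d a)) partialD IH IH' addrACA.
- by rewrite partialC cend1_op0l !cend1_opC add0r partialZ.
- rewrite partial_D cend1_opDdl !cend1_opDl partialN partialMn IH /=.
  case: n => [|n]; first by rewrite !mulr0n !oppr0 addr0 subrr.
  by rewrite /= mulrnDl mulrS !opprD addrACA subrr add0r.
- by rewrite partial_x cend1_opDdl !cend1_opx partial_x IH mulrDl addrA.
Qed.

Lemma iter_partial_op n m a b :
  \sum_(s < n.+1)
    (-1) ^+ s *: (iter (n - s) d (cend1_op (m + s) a b) *+ 'C(n, s))
  = cend1_op m (iter n d a) b.
Proof.
elim: n m => [|n IH] m; first by rewrite big_ord1 bin0 scale1r addn0.
have -> : cend1_op m (iter n.+1 d a) b =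
    d (cend1_op m (iter n d a) b) - cend1_op m.+1 (iter n d a) b.
  by rewrite partial_op addrK.
rewrite -!IH (big_morph d partialD (iter_partial0 1)) -sumrN.
rewrite big_ord_recl [X in X + _ = _](_ : _ = d (iter n d (cend1_op m a b))); last first.
  by rewrite !subn0 addn0 bin0 scale1r.
under [X in _ + X = _]eq_bigr => i _ do rewrite lift0 binS mulrnDr scalerDr.
rewrite big_split addrA; congr (_ + _); last first.
  by apply: eq_bigr => i _; rewrite exprS mulN1r scaleNr subSS addSnnS.
rewrite big_ord_recr /= bin_small // mulr0n scaler0 addr0 big_ord_recl /=.
congr (_ + _); first by rewrite subn0 addn0 bin0 scale1r.
apply: eq_bigr => i _; rewrite /bump /= !add1n subSS.
have -> : (n - i = (n - i.+1).+1)%N by rewrite subnSK.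
by rewrite -signr_odd !scaler_sign [in RHS]fun_if partialN partialMn.
Qed.

Lemma cend1_op_assoc : conformal_assoc (@cend1_op F) (@cend1_op F)
  (@cend1_op F) (@cend1_op F).
Proof.
move=> n m a b c; move: n m.
elim/cend1_ind: a => [a a' IH IH'|e|a IH|a IH] n m.
- rewrite !cend1_opDdl IH IH' -big_split; apply: eq_bigr => s _ /=.
  by rewrite cend1_opDdl mulrnDl scalerDr.
- rewrite cend1_opC cend1_opZl -iter_partial_op scaler_sumr.
  apply: eq_bigr => s _; rewrite cend1_opC.
  by rewrite [in RHS]scalerMnr !scalerA mulrC.
- rewrite cend1_opDl cend1_opNMl IH [in RHS]big_ord_recr /= subnn.
  rewrite cend1_opDl mulr0n oppr0 mul0rn scaler0 addr0.
  case: n => [|n]; first by rewrite mulr0n big_ord0 oppr0.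
  rewrite /= -sumrMnl -sumrN; apply: eq_bigr => s _.
  have le_sn : (s <= n)%N by rewrite -ltnS ltn_ord.
  rewrite cend1_opDl subSn //= -subSn // mulNrn scalerN -mulrnA -mul_bin_down.
  by rewrite mulnC mulrnA scalerMnr.
- rewrite cend1_opx cend1_opx IH mulr_suml; apply: eq_bigr => s _.
  by rewrite cend1_opx -mulrnAl scalerAl.
Qed.

Lemma cend1_op_locality a b : exists N : nat, forall n, (N <= n)%N ->
  cend1_op n a b = 0.
Proof.
have pred_le N n : (N.+1 <= n)%N -> (N <= n.-1)%N by case: n.
have nil_b : exists N : nat, forall n, (N <= n)%N -> iter n d b = 0.
  elim/cend1_ind: b => [b b' [N HN] [N' HN']|c|b [N HN]|b [N HN]].
  - exists (maxn N N') => n; rewrite geq_max => /andP[/HN E /HN' E'].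
    by rewrite iter_partialD E E' addr0.
  - by exists 1%N => -[//|n] _; rewrite iterSr partialC iter_partial0.
  - exists N.+1 => n lt_Nn; rewrite iter_partial_D HN ?(ltnW lt_Nn) // HN ?pred_le //.
    by rewrite scaler0 mul0rn addr0.
  - exists N.+1 => n lt_Nn; rewrite iter_partial_x HN ?(ltnW lt_Nn) // HN ?pred_le //.
    by rewrite mul0r mul0rn addr0.
elim/cend1_ind: a => [a a' [N HN] [N' HN']|c|a [N HN]|a [N HN]].
- exists (maxn N N') => n; rewrite geq_max => /andP[/HN E /HN' E'].
  by rewrite cend1_opDdl E E' addr0.
- by have [N HN] := nil_b; exists N => n /HN E; rewrite cend1_opC E scaler0.
- by exists N.+1 => n /pred_le /HN E; rewrite cend1_opDl E mul0rn oppr0.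
- by exists N => n /HN E; rewrite cend1_opx E mul0r.
Qed.

Lemma cend1_conformal : assoc_conformal_algebra (@cend1_op F).
Proof.
split; last exact: cend1_op_assoc.
split; [exact: cend1_op_linearl | exact: cend1_op_linearr |
  exact: cend1_op_locality | exact: cend1_opDl | exact: cend1_opDr].
Qed.

Lemma cend1_opXn n k l :
  cend1_op n ('X^k : R) 'X^l = 'X^k * ('X^l)^`(n).
Proof.
have dX j : d 'X^j = ('X^j : R)^`().
  rewrite /partial -[RHS]add0r; congr (_ + _); apply/polyP=> i.
  by rewrite coef_map_id0 ?linear0 // coefXn coef0 -polyC_natr derivC.
have -> : ('X^l : R)^`(n) = iter n d 'X^l.
  elim: n => // n IH; rewrite iterS -IH derivnS derivnXn derivMn -dX.
  by rewrite partialMn.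
elim: k => [|k IH]; last by rewrite exprSr cend1_opx IH mulrAC.
by rewrite expr0 mul1r -!polyC1 cend1_opC polyC1 scale1r.
Qed.

End Cend1.

(* Cend_{1,x} = x F[D,x]: zero constant term in the outer variable x. *)
Definition xideal (F : fieldType) : {pred {poly {poly F}}} :=
  [pred a : {poly {poly F}} | a`_0 == 0].

Lemma xidealP (F : fieldType) (a : {poly {poly F}}) :
  reflect (exists b, a = 'X * b) (a \in @xideal F).
Proof.
apply: (iffP eqP) => [a0 | [b ->]]; last by rewrite coefXM.
elim/poly_ind: a a0 => [|b c _]; first by exists 0; rewrite mulr0.
by rewrite coefD coefMX coefC add0r /= => ->; exists b; rewrite addr0 mulrC.
Qed.

Lemma xideal_submod_closed (F : fieldType) : submod_closed (@xideal F).
Proof.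
split=> [|p a b]; rewrite !inE ?coef0 // => /eqP a0 /eqP b0.
by rewrite coefD coefZ a0 b0 mulr0 addr0.
Qed.

HB.instance Definition _ (F : fieldType) :=
  GRing.isSubmodClosed.Build {poly F} {poly {poly F}} (@xideal F)
    (@xideal_submod_closed F).

Record cend1x (F : fieldType) := Cend1x {
  cend1x_val :> {poly {poly F}};
  _ : cend1x_val \in @xideal F
}.

HB.instance Definition _ (F : fieldType) := [isSub for @cend1x_val F].
HB.instance Definition _ (F : fieldType) := [Choice of cend1x F by <:].
HB.instance Definition _ (F : fieldType) :=
  [SubChoice_isSubLmodule of cend1x F by <:].

Lemma cend1_op_xideal (F : fieldType) n (a b : cend1x F) :
  cend1_op n (val a) (val b) \in @xideal F.
Proof.
have /xidealP[c ->] := valP a.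
by apply/xidealP; exists (cend1_op n c (val b)); rewrite mulrC cend1_opx mulrC.
Qed.

Definition cend1x_op (F : fieldType) (n : nat) (a b : cend1x F) : cend1x F :=
  Cend1x (cend1_op_xideal n a b).

Lemma cend1x_conformal (F : fieldType) :
  assoc_conformal_algebra (@cend1x_op F).
Proof.
have [[ll lr loc Dl Dr] ass] := cend1_conformal F.
split; last first.
  move=> n m a b c; apply: val_inj.
  rewrite [RHS]raddf_sum [LHS](ass n m); apply: eq_bigr => s _.
  by rewrite [RHS]linearZ [in RHS]raddfMn.
split.
- by move=> n c a a' b; apply: val_inj; exact: (ll n c (val a)).
- by move=> n c a b b'; apply: val_inj; exact: (lr n c (val a)).
- move=> a b; have [N HN] := loc (val a) (val b).
  by exists N => n /HN E; apply: val_inj.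
- move=> n a b; apply: val_inj; rewrite [RHS]raddfN [in RHS]raddfMn.
  exact: (Dl n (val a)).
- move=> n a b; apply: val_inj; rewrite [RHS]raddfD [in RHS]raddfMn.
  exact: (Dr n (val a)).
Qed.

(* Main.v *)
Require Import Defs.
From HB Require Import structures.
From mathcomp Require Import all_boot all_algebra.

Set Implicit Arguments.
Unset Strict Implicit.
Unset Printing Implicit Defensive.

Import GRing.Theory.
Local Open Scope ring_scope.

(** The algebra C is generated by x, subject to x o_1 x = x and x o_n x = 0
for n >= 2: the operator x o_0 turns x^k into x^(k+1), so that x determines
everything else.  A 2-cocycle phi describes an extension E of C by M with zero
multiplication on M, and phi is a coboundary as soon as some lift x - v of x to
E satisfies the same two relations.

Write L_n u = x o_n u and R_n u = u o_n x for the actions on M, and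
f_n = phi_n(x,x).  The relations for x - v say that v solves
<<
      L_1 v + R_1 v - v = f_1    and    L_n v + R_n v = f_n  for n >= 2.
>>
Only the first equation has to be solved.  Once f_1 = 0, the cocycle identity
on (x,x,x) reads L_1 f_n = f_n + L_0 f_(n+1) for n >= 2 and L_0 f_2 = 0; the
kernel of L_0 is annihilated by all L_n, and comparing the two facts gives
L_0^k f_(n+k) = (-1)^k k! f_n whenever L_0 f_n = 0, so locality forces f_n = 0,
one n after the other ([cocycle_xx_eq0]).

To solve the first equation ([cocycle_xx_solvable]), call y solvable when it is
L_1 v + R_1 v - v for some v. The elements v with R_1 v = v, R_n v = 0 for
n >= 2 form a subspace stable under the L_n and containing the image of every
R_n; on it the equation is just L_1 v = y. By locality L_1 hits every L_0 z: L_n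
acts like x (d/dx)^n, and on x^(k+1) (d/dx)^n the operator L_1 has eigenvalue
k + 1 up to a term with one more derivative, so it can be inverted by a finite
descent ([lact1_solve]). Hence L_0 R_n u is always solvable, and the cocycle
identity writes f_1 as a combination of such elements and of values of the
operator L_1 + R_1 - 1.

With v found, tau(x) = v extends to powers of x by the recursion that makes
phi_0(x,x^k) trivial, and then to C by H-linearity.  The cocycle
phi - delta_1 tau vanishes on (x,x) and, for the product o_0, on every (x,x^k);
the cocycle identity propagates this to all of C ([cocycle_vanish]). *)

(** * Inverting the associativity formula *)

Lemma sum_binS (V : nmodType) (f : nat -> V) m :
  \sum_(s < m.+2) f s *+ 'C(m.+1, s) =
  \sum_(s < m.+1) (f s + f s.+1) *+ 'C(m, s).
Proof.
rewrite big_ord_recl bin0.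
under eq_bigr => s _ do rewrite lift0 binS mulrnDr.
rewrite big_split /= addrA.
under [RHS]eq_bigr => s _ do rewrite mulrnDl.
rewrite [RHS]big_split /=; congr (_ + _).
by rewrite big_ord_recr /= bin_small // mulr0n addr0 [RHS]big_ord_recl bin0.
Qed.

(** Induction on m by Pascal's rule, which splits A (i+1) j into the transform
of G (i+1) j minus A i (j+1), and the sum sought at m + 1 into the sums at m
for the two families A (i+1) j and A i (j+1). *)
Lemma binomial_inversion (R : pzRingType) (V : lmodType R)
    (A G : nat -> nat -> V) :
  (forall m n, A m n =
     \sum_(s < m.+1) (-1) ^+ s *: (G (m - s)%N (n + s)%N *+ 'C(m, s))) ->
  forall m n, G m n = \sum_(s < m.+1) A (m - s)%N (n + s)%N *+ 'C(m, s).
Proof.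
move=> AG m; elim: m => [|m IH] in A G AG *; move=> n.
  by rewrite big_ord1 AG big_ord1 !addn0 scale1r.
rewrite (sum_binS (fun s => A (m.+1 - s)%N (n + s)%N)).
rewrite [LHS](IH (fun i j => A i.+1 j + A i j.+1) (fun i => G i.+1));
  last first.
  move=> i j; rewrite !AG.
  under eq_bigr => s _ do rewrite -scalerMnr.
  rewrite (sum_binS (fun s => (-1) ^+ s *: G (i.+1 - s)%N (j + s)%N)).
  rewrite -big_split; apply: eq_bigr => s _ /=.
  have le_si : (s <= i)%N by rewrite -ltnS.
  rewrite -scalerMnr -mulrnDl exprS mulN1r scaleNr subSS addSnnS subrK.
  by rewrite -scalerMnr subSn.
apply: eq_bigr => s _; have le_sm : (s <= m)%N by rewrite -ltnS.
by rewrite subSS subSn // addnS.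
Qed.

Section ConformalMap.
Variable (F : fieldType).

(** The form in which associativity occurs in the differential: products
associated to the right in terms of products associated to the left. *)
Lemma conformal_assoc_inv (A B C AB BC V : lmodType {poly F})
    (opAB : nat -> A -> B -> AB) (opABC : nat -> AB -> C -> V)
    (opBC : nat -> B -> C -> BC) (opA_BC : nat -> A -> BC -> V) :
  conformal_assoc opAB opABC opBC opA_BC ->
  forall m n a b c, opA_BC m a (opBC n b c) =
    \sum_(s < m.+1) opABC (n + s)%N (opAB (m - s)%N a b) c *+ 'C(m, s).
Proof.
move=> assoc m n a b c.
by apply: (binomial_inversion (A := fun i j => opABC j (opAB i a b) c)
  (G := fun i j => opA_BC i a (opBC j b c))) => i j; exact: assoc.
Qed.

(** * Conformal maps *)

Section Theory.
Variables (A B V : lmodType {poly F}) (f : nat -> A -> B -> V).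
Hypothesis cf : conformal_map f.

Fact cmapl_zmod n b : zmod_morphism (f n ^~ b).
Proof.
move=> a a'; rewrite -[in LHS](scaleN1r a') addrC -polyC1 -polyCN.
by rewrite (cmap_linearl cf) polyCN polyC1 scaleN1r addrC.
Qed.

Fact cmapr_zmod n a : zmod_morphism (f n a).
Proof.
move=> b b'; rewrite -[in LHS](scaleN1r b') addrC -polyC1 -polyCN.
by rewrite (cmap_linearr cf) polyCN polyC1 scaleN1r addrC.
Qed.

Definition cmapl n b : {additive A -> V} :=
  HB.pack (f n ^~ b) (GRing.isZmodMorphism.Build A V _ (cmapl_zmod n b)).
Definition cmapr n a : {additive B -> V} :=
  HB.pack (f n a) (GRing.isZmodMorphism.Build B V _ (cmapr_zmod n a)).

Lemma cmap0l n b : f n 0 b = 0. Proof. exact: raddf0 (cmapl n b). Qed.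
Lemma cmapDl n b a a' : f n (a + a') b = f n a b + f n a' b.
Proof. exact: raddfD (cmapl n b) a a'. Qed.
Lemma cmapBl n b a a' : f n (a - a') b = f n a b - f n a' b.
Proof. exact: raddfB (cmapl n b) a a'. Qed.
Lemma cmap0r n a : f n a 0 = 0. Proof. exact: raddf0 (cmapr n a). Qed.
Lemma cmapNr n a b : f n a (- b) = - f n a b.
Proof. exact: raddfN (cmapr n a) b. Qed.
Lemma cmapDr n a b b' : f n a (b + b') = f n a b + f n a b'.
Proof. exact: raddfD (cmapr n a) b b'. Qed.
Lemma cmapBr n a b b' : f n a (b - b') = f n a b - f n a b'.
Proof. exact: raddfB (cmapr n a) b b'. Qed.
Lemma cmapMnr n a k b : f n a (b *+ k) = f n a b *+ k.
Proof. exact: raddfMn (cmapr n a) k b. Qed.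
Lemma cmapZl n b (c : F) a : f n (c%:P *: a) b = c%:P *: f n a b.
Proof. by rewrite -[_ *: a]addr0 (cmap_linearl cf) cmap0l addr0. Qed.
Lemma cmapZr n a (c : F) b : f n a (c%:P *: b) = c%:P *: f n a b.
Proof. by rewrite -[_ *: b]addr0 (cmap_linearr cf) cmap0r addr0. Qed.

End Theory.

Lemma conformal_mapD (A B V : lmodType {poly F}) (f g : nat -> A -> B -> V) :
  conformal_map f -> conformal_map g ->
  conformal_map (fun n a b => f n a b + g n a b).
Proof.
move=> cf cg; split=> [n c a a' b|n c a b b'|a b|n a b|n a b].
- by rewrite (cmap_linearl cf) (cmap_linearl cg) scalerDr addrACA.
- by rewrite (cmap_linearr cf) (cmap_linearr cg) scalerDr addrACA.
- have [N fN] := cmap_locality cf a b; have [N' gN'] := cmap_locality cg a b.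
  exists (maxn N N') => n; rewrite geq_max => /andP[/fN -> /gN' ->].
  exact: addr0.
- by rewrite (cmap_Dl cf) (cmap_Dl cg) mulrnDl opprD.
- by rewrite (cmap_Dr cf) (cmap_Dr cg) mulrnDl scalerDr addrACA.
Qed.

Lemma conformal_map_comp (A A' B B' V V' : lmodType {poly F})
    (f : nat -> A -> B -> V) (h : {linear V -> V'})
    (k : {linear A' -> A}) (l : {linear B' -> B}) :
  conformal_map f -> conformal_map (fun n a b => h (f n (k a) (l b))).
Proof.
move=> cf; split=> [n c a a' b|n c a b b'|a b|n a b|n a b].
- by rewrite linearP (cmap_linearl cf) linearP.
- by rewrite linearP (cmap_linearr cf) linearP.
- have [N fN] := cmap_locality cf (k a) (l b).
  by exists N => n /fN ->; rewrite linear0.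
- by rewrite linearZ (cmap_Dl cf) linearN raddfMn.
- by rewrite linearZ (cmap_Dr cf) linearD raddfMn linearZ.
Qed.

Lemma poly_scaler_closed (V : lmodType {poly F}) (P : V -> Prop) :
  P 0 -> (forall u v, P u -> P v -> P (u + v)) ->
  (forall (c : F) u, P u -> P (c%:P *: u)) ->
  (forall u, P u -> P ('X *: u)) ->
  forall p u, P u -> P (p *: u).
Proof.
move=> P0 PD PZ PX p u Pu; elim/poly_ind: p => [|p c IHp].
  by rewrite scale0r.
by rewrite scalerDl mulrC -scalerA; apply: PD; [exact: PX | exact: PZ].
Qed.

End ConformalMap.

(** * Coboundaries are cocycles *)

Section Coboundary.
Variables (F : fieldType) (A M : lmodType {poly F}).
Variable (op : nat -> A -> A -> A).
Variables (lact : nat -> A -> M -> M) (ract : nat -> M -> A -> M).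
Hypothesis (HA : assoc_conformal_algebra op).
Hypothesis (HM : conformal_bimodule op lact ract).

Lemma conformal_delta1 (tau : {linear A -> M}) :
  conformal_map (delta1 op lact ract tau).
Proof.
have cl := conformal_map_comp idfun idfun tau (cbim_left HM).
have co := conformal_map_comp (\- tau) idfun idfun (aca_conformal HA).
have cr := conformal_map_comp idfun tau idfun (cbim_right HM).
exact: conformal_mapD (conformal_mapD cl co) cr.
Qed.

Lemma conformal_subdelta1 (phi : nat -> A -> A -> M) (tau : {linear A -> M}) :
  conformal_map phi ->
  conformal_map (fun n a b => phi n a b - delta1 op lact ract tau n a b).
Proof.
move=> cphi; apply: conformal_mapD cphi _.
exact: conformal_map_comp (\- idfun) idfun idfun (conformal_delta1 tau).
Qed.

Lemma delta2B (phi psi : nat -> A -> A -> M) m n a b c :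
  delta2 op lact ract (fun n a b => phi n a b - psi n a b) m n a b c =
  delta2 op lact ract phi m n a b c - delta2 op lact ract psi m n a b c.
Proof.
have [cl _ cr _ _] := HM.
rewrite /delta2 (cmapBr cl).
under eq_bigr => s _ do rewrite (cmapBl cr) addrACA -opprD mulrnBl.
by rewrite sumrB addrACA -opprD [- (_ - _)]opprD addrACA -opprD.
Qed.

(** Once [conformal_assoc_inv] has associated the products in the first two terms
to the left, they meet their opposites in the sum over s; only the two terms
a o tau(b o c) cancel between themselves. *)
Lemma delta2_delta1 (tau : {linear A -> M}) m n a b c :
  delta2 op lact ract (delta1 op lact ract tau) m n a b c = 0.
Proof.
have [cl la cr ra ba] := HM.
have inv := conformal_assoc_inv.
rewrite /delta2 /delta1 (cmapDr cl) (cmapBr cl).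
rewrite (inv _ _ _ _ _ _ _ _ _ _ _ la) (inv _ _ _ _ _ _ _ _ _ _ _ ba).
rewrite (inv _ _ _ _ _ _ _ _ _ _ _ ra).
rewrite (inv _ _ _ _ _ _ _ _ _ _ _ (aca_assoc HA)).
rewrite raddf_sum /=.
under [X in _ - X]eq_bigr => s _.
  rewrite (cmapDl cr) (cmapBl cr) [X in _ + X]addrAC addrACA subrr addr0.
  rewrite mulrnDl mulrnBl mulrnDl.
  over.
rewrite big_split /= sumrB big_split /=.
under [X in _ + (_ - X + _)]eq_bigr => s _ do rewrite raddfMn.
have telescope (P T Q U W : M) : P - T + Q + (T - U + W) = P - U + (Q + W).
  by rewrite addrAC -[T - U + W]addrA addrA subrK addrA -addrA [W + Q]addrC.
by rewrite telescope subrr.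
Qed.

End Coboundary.

(** * Division by positive integers and descending induction *)

Lemma divn_char0 (F : fieldType) (M : lmodType {poly F}) n (u : M) :
  [pchar F] =i pred0 -> ((n.+1%:R^-1 : F)%:P *: u) *+ n.+1 = u.
Proof.
move=> /pcharf0P ch0; rewrite -scaler_nat scalerA -polyC_natr -polyCM mulfV.
  by rewrite polyC1 scale1r.
by rewrite ch0.
Qed.

Lemma mulrSn_eq0 (F : fieldType) (M : lmodType {poly F}) n (u : M) :
  [pchar F] =i pred0 -> u *+ n.+1 = 0 -> u = 0.
Proof.
by move=> ch0 un0; rewrite -(divn_char0 n u ch0) scalerMnr un0 scaler0.
Qed.

(** The shape in which locality is used. *)
Lemma descending_ind (P : nat -> Prop) :
  (exists N, forall n, (N <= n)%N -> P n) -> (forall n, P n.+1 -> P n) ->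
  forall n, P n.
Proof.
move=> [N PN] PS n; suff: forall d n, (N <= n + d)%N -> P n.
  by apply; exact: leq_addl.
elim=> [|d IH] {}n; first by rewrite addn0; exact: PN.
by rewrite addnS -addSn => /IH/PS.
Qed.

(** * The monomials of Cend_(1,x) *)

Section Monomials.
Variable F : fieldType.
Local Notation C := (cend1x F).

Fact xmon_subproof k : ('X^(k.+1) : {poly {poly F}}) \in @xideal F.
Proof. by rewrite inE coefXn. Qed.

(** [xmon k] is x^(k+1), because C = x F[D,x] starts in degree 1; the generator
x itself is [xmon 0]. *)
Definition xmon k : C := Cend1x (xmon_subproof k).

Lemma xmon_op0 k : cend1x_op 0 (xmon 0) (xmon k) = xmon k.+1.
Proof. by apply: val_inj; rewrite /= cend1_opXn derivn0 -exprD. Qed.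

Lemma xmon_op1 : cend1x_op 1 (xmon 0) (xmon 0) = xmon 0.
Proof. by apply: val_inj; rewrite /= cend1_opXn derivn1 expr1 derivX mulr1. Qed.

Lemma xmon_op_ge2 n : cend1x_op n.+2 (xmon 0) (xmon 0) = 0.
Proof.
apply: val_inj; rewrite /= cend1_opXn derivn_poly0 ?mulr0 //.
by rewrite size_polyXn.
Qed.

Lemma cend1x_sum (a : C) k : (size (val a) <= k)%N ->
  a = \sum_(i < k) (val a)`_i.+1 *: xmon i.
Proof.
move=> le_ak; apply: val_inj; rewrite linear_sum.
under [RHS]eq_bigr => i _ do rewrite linearZ /=.
have a0 : (val a)`_0 = 0 by apply/eqP; exact: (valP a).
apply/polyP=> -[|j].
  rewrite a0 coef_sum big1 // => i _.
  by rewrite coefZ coefXn mulr0.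
rewrite coef_sum.
have [lt_jk|le_kj] := ltnP j k.
  rewrite (bigD1 (Ordinal lt_jk)) //= coefZ coefXn eqxx mulr1.
  rewrite big1 ?addr0 // => i ne_ij; rewrite coefZ coefXn eqSS.
  by rewrite eq_sym (negPf (ne_ij : val i != j)) mulr0.
rewrite nth_default ?big1 // => [i _|]; last first.
  by apply: leq_trans (leqW le_kj).
rewrite coefZ coefXn eqSS gtn_eqF ?mulr0 //.
exact: leq_trans le_kj.
Qed.

Lemma cend1x_ind (P : C -> Prop) :
  P 0 -> (forall a b, P a -> P b -> P (a + b)) ->
  (forall (c : F) a, P a -> P (c%:P *: a)) ->
  (forall a, P a -> P ('X *: a)) ->
  (forall k, P (xmon k)) -> forall a, P a.
Proof.
move=> P0 PD PZ PX Px a; rewrite (cend1x_sum (leqnn (size (val a)))).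
by apply: big_ind => // i _; exact: (poly_scaler_closed P0 PD PZ PX).
Qed.

Section LinearExtension.
Variables (M : lmodType {poly F}) (t : nat -> M).

Definition xmon_ext (a : C) : M :=
  \sum_(i < size (val a)) (val a)`_i.+1 *: t i.

Lemma xmon_ext_widen (a : C) k : (size (val a) <= k)%N ->
  xmon_ext a = \sum_(i < k) (val a)`_i.+1 *: t i.
Proof.
move=> le_ak; pose E i := (val a)`_i.+1 *: t i.
rewrite /xmon_ext (big_ord_widen _ E le_ak) /E.
rewrite big_mkcond; apply: eq_bigr => i _; case: ltnP => // le_ai.
by rewrite nth_default ?scale0r // (leq_trans le_ai).
Qed.

Fact xmon_ext_is_linear : linear xmon_ext.
Proof.
move=> p a b; pose sz (c : C) := size (val c).
set k := maxn (sz (p *: a + b)) (maxn (sz a) (sz b)).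
rewrite !(@xmon_ext_widen _ k) ?leq_max ?leqnn ?orbT //.
rewrite scaler_sumr -big_split; apply: eq_bigr => i _.
by rewrite linearP /= coefD coefZ scalerDl scalerA.
Qed.

HB.instance Definition _ :=
  GRing.isLinear.Build {poly F} C M *:%R xmon_ext xmon_ext_is_linear.

Lemma xmon_extE k : xmon_ext (xmon k) = t k.
Proof.
rewrite (@xmon_ext_widen _ k.+2) /= ?size_polyXn //.
rewrite (bigD1 (Ordinal (leqnSn k.+1))) //= coefXn eqxx scale1r.
rewrite big1 ?addr0 // => i ne_ik.
by rewrite coefXn eqSS (negPf (ne_ik : val i != k)) scale0r.
Qed.

End LinearExtension.

(** Sums over all x o_(m-s) x reduce to the two nonzero products x o_0 x = x^2
and x o_1 x = x. *)
Lemma sum_xmon_op (V : zmodType) (g : nat -> C -> V) m :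
  (forall s, g s 0 = 0) ->
  \sum_(s < m.+1) g s (cend1x_op (m - s) (xmon 0) (xmon 0)) *+ 'C(m, s) =
  g m (xmon 1) + g m.-1 (xmon 0) *+ m.
Proof.
move=> g0; rewrite big_ord_recr /= subnn xmon_op0 binn mulr1n addrC.
congr (_ + _); case: m => [|m]; first by rewrite big_ord0 mulr0n.
rewrite big_ord_recr /= subSnn xmon_op1 binSn big1 ?add0r // => i _.
have -> : (m.+1 - i = (m - i.+1).+2)%N by rewrite subnSK // subSn // ltnW.
by rewrite xmon_op_ge2 g0 mul0rn.
Qed.

End Monomials.

(** * The generator acting on a bimodule *)

Section Bimodule.
Variables (F : fieldType) (M : lmodType {poly F}).
Variables (lact : nat -> cend1x F -> M -> M) (ract : nat -> M -> cend1x F -> M).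
Hypothesis charF0 : [pchar F] =i pred0.
Hypothesis HM : conformal_bimodule (@cend1x_op F) lact ract.

Local Notation C := (cend1x F).
Local Notation x := (xmon F 0).
Local Notation L n u := (lact n x u).
Local Notation R n u := (ract n u x).

Let cl : conformal_map lact := cbim_left HM.
Let cr : conformal_map ract := cbim_right HM.

Lemma lact1_lact n u : L 1 (L n u) = L n u + L 0 (L n.+1 u).
Proof.
rewrite (conformal_assoc_inv (cbim_left_assoc HM)) big_ord_recl big_ord1 /=.
rewrite addn0 addn1 xmon_op1 [in RHS](conformal_assoc_inv (cbim_left_assoc HM)).
by rewrite big_ord1 addn0.
Qed.

Lemma lact_lact0 m u : L m (L 0 u) = L 0 (L m u) + L m.-1 u *+ m.
Proof.
rewrite !(conformal_assoc_inv (cbim_left_assoc HM)) big_ord1 addn0.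
rewrite (sum_xmon_op (g := fun s a => lact s a u)) ?xmon_op0 // => s.
exact: cmap0l.
Qed.

(** The hypothesis is met by the families L_n z and, once f_1 = 0, by f_n with
n >= 2, taking for v the next member in each case; the weight of L_1 on L_0^k u
is k + 1 up to passing to that next member. *)
Lemma lact1_iter0 k u v : L 1 u = u + L 0 v ->
  L 1 (iter k (lact 0 x) u) =
  iter k (lact 0 x) u *+ k.+1 + iter k.+1 (lact 0 x) v.
Proof.
move=> Lu; elim: k => [//|k IH].
rewrite iterS lact_lact0 IH (cmapDr cl) (cmapMnr cl) -!iterS.
by rewrite addrAC -mulrSr.
Qed.

Lemma ract1_ract n u : R 1 (R n u) = R n u.
Proof.
rewrite (cbim_right_assoc HM) big_ord_recl xmon_op1 bin0 scale1r subn0.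
rewrite big1 ?addr0 // => i _.
by rewrite lift0 addnS xmon_op_ge2 (cmap0r cr) mul0rn scaler0.
Qed.

Lemma ract_ract m n u : R m.+2 (R n u) = 0.
Proof.
rewrite (cbim_right_assoc HM) big1 // => i _.
by rewrite !addSn xmon_op_ge2 (cmap0r cr) mul0rn scaler0.
Qed.

Lemma ract_lact0 m u : R m (L 0 u) = L 0 (R m u).
Proof. by rewrite (cbim_assoc HM) big_ord1 scale1r addn0. Qed.

Lemma ract_lact1 m u : R m (L 1 u) = L 1 (R m u) - L 0 (R m.+1 u).
Proof.
rewrite (cbim_assoc HM) big_ord_recl big_ord1 /= scale1r addn0 scaleN1r.
by rewrite addn1.
Qed.

(** Here R behaves as on the powers of x in C: x^k o_1 x = x^k and x^k o_n x = 0
for n >= 2. *)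
Definition right_unital u := R 1 u = u /\ forall n, R n.+2 u = 0.

Lemma right_unital_ract n u : right_unital (R n u).
Proof. by split=> [|m]; [exact: ract1_ract | exact: ract_ract]. Qed.

Lemma right_unital0 : right_unital 0.
Proof. by split=> [|n]; rewrite (cmap0l cr). Qed.

Lemma right_unitalB u v : right_unital u -> right_unital v ->
  right_unital (u - v).
Proof.
move=> [u1 u2] [v1 v2].
by split=> [|n]; rewrite (cmapBl cr) ?u1 ?v1 // u2 v2 subr0.
Qed.

Lemma right_unitalZ (c : F) u : right_unital u -> right_unital (c%:P *: u).
Proof.
by move=> [u1 u2]; split=> [|n]; rewrite (cmapZl cr) ?u1 // u2 scaler0.
Qed.

Lemma right_unital_lact n u : right_unital u -> right_unital (L n u).
Proof.
move=> [u1 u2].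
have comm m : (0 < m)%N -> R m (L n u) = L n (R m u).
  case: m => // m _; rewrite (cbim_assoc HM) big_ord_recl big1 => [|i _].
    by rewrite addr0 subn0 bin0 scale1r addn0.
  by rewrite lift0 addSnnS !addnS u2 (cmap0r cl) mul0rn scaler0.
by split=> [|m]; rewrite comm // ?u1 // u2 (cmap0r cl).
Qed.

(** L_0 lowers the index: if L_0 u = 0 then L_0 L_(m+1) u = - (m+1) L_m u, so
the vanishing of L_n u for large n descends to all n. *)
Lemma lact0_ker n u : L 0 u = 0 -> L n u = 0.
Proof.
move=> Lu0.
have lower m : L 0 (L m.+1 u) = - (L m u *+ m.+1).
  apply/eqP; rewrite -subr_eq0 opprK.
  by rewrite -(lact_lact0 m.+1) Lu0 (cmap0r cl).
elim/descending_ind: n => [|n L0]; first exact: cmap_locality cl x u.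
apply: (@mulrSn_eq0 _ _ n _ charF0).
by rewrite -[_ *+ _]opprK -lower L0 (cmap0r cl) oppr0.
Qed.

Lemma iter_lact0_0 k : iter k (lact 0 x) 0 = 0.
Proof. by elim: k => //= k ->; exact: cmap0r cl _ _. Qed.

(** L_1 maps L_0^a L_a z to (a+1) L_0^a L_a z + L_0^(a+1) L_(a+1) z, so a
preimage of L_0^a L_a z is found by descent from the large a, where L_a z = 0. *)
Lemma lact1_solve z :
  exists w, L 1 w = L 0 z /\ (right_unital z -> right_unital w).
Proof.
suff solve a : exists w,
    L 1 w = iter a (lact 0 x) (L a z) /\ (right_unital z -> right_unital w).
  exact: (solve 0%N).
elim/descending_ind: a => [|a [w [Lw uw]]].
  have [N LN] := cmap_locality cl x z; exists N => a /LN ->.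
  exists 0; split=> [|_]; last exact: right_unital0.
  by rewrite iter_lact0_0 (cmap0r cl).
exists ((a.+1%:R^-1 : F)%:P *: (iter a (lact 0 x) (L a z) - w)).
split=> [|uz].
  rewrite (cmapZr cl) (cmapBr cl) (lact1_iter0 _ (lact1_lact a z)) Lw addrK.
  by rewrite -scalerMnr divn_char0.
apply: right_unitalZ; apply: right_unitalB; last exact: uw.
by elim: {1}a => /= [|k]; exact: right_unital_lact.
Qed.

(** In the extension of C by M with cocycle psi, the lift x - v of x satisfies
e o_1 e = e exactly when psi_1(x,x) is L_1 v + R_1 v - v. *)
Definition solvable y := exists v, L 1 v + R 1 v - v = y.

Lemma solvableB y z : solvable y -> solvable z -> solvable (y - z).
Proof.
move=> [v <-] [w <-]; exists (v - w).
rewrite (cmapBr cl) (cmapBl cr) addrACA -opprD.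
by rewrite [- (v - w)]opprD addrACA -opprD.
Qed.

Lemma solvableD y z : solvable y -> solvable z -> solvable (y + z).
Proof.
move=> sy sz; rewrite -[z]opprK; apply: solvableB => //.
have s0 : solvable 0 by rewrite -(subrr z); exact: solvableB.
by rewrite -[- z]sub0r; exact: solvableB.
Qed.

Lemma solvable_lact0 u : right_unital u -> solvable (L 0 u).
Proof.
have [w [Lw uw]] := lact1_solve u => /uw[w1 _].
by exists w; rewrite Lw w1 addrK.
Qed.

(** * Cocycles on the generator *)

Section Cocycle.
Variable psi : nat -> C -> C -> M.
Hypothesis cpsi : conformal_map psi.
Hypothesis psiK : forall m n a b c,
  delta2 (@cend1x_op F) lact ract psi m n a b c = 0.

Local Notation f n := (psi n x x).

Lemma cocycle_eq m n a b c :
  lact m a (psi n b c) + psi m a (cend1x_op n b c) =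
  \sum_(s < m.+1) (psi (n + s)%N (cend1x_op (m - s) a b) c
                   + ract (n + s)%N (psi (m - s)%N a b) c) *+ 'C(m, s).
Proof. by apply/eqP; rewrite -subr_eq0; apply/eqP; exact: psiK. Qed.

Lemma cocycle_at0 n a b c :
  lact 0 a (psi n b c) + psi 0 a (cend1x_op n b c) =
  psi n (cend1x_op 0 a b) c + ract n (psi 0 a b) c.
Proof. by rewrite cocycle_eq big_ord1 addn0. Qed.

(** The cocycle identities at (1,n) and (0,n+1) on (x,x,x), with the unknown
psi_(n+1)(x^2,x) eliminated between them. *)
Lemma cocycle_xx n : L 1 (f n) + psi 1 x (cend1x_op n x x) =
  L 0 (f n.+1) + psi 0 x (cend1x_op n.+1 x x) + f n + R n (f 1).
Proof.
rewrite cocycle_eq cocycle_at0 big_ord_recl big_ord1 /= addn0 addn1.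
by rewrite xmon_op0 xmon_op1 !mulr1n addrC -!addrA.
Qed.

Lemma cocycle_xx1 : L 1 (f 1) = L 0 (f 2) + R 1 (f 1).
Proof.
have := cocycle_xx 1; rewrite xmon_op1 xmon_op_ge2 (cmap0r cpsi) addr0.
by rewrite addrAC => /addIr.
Qed.

Lemma cocycle_xx_ge2 n : L 1 (f n.+2) = f n.+2 + L 0 (f n.+3) + R n.+2 (f 1).
Proof.
have := cocycle_xx n.+2; rewrite !xmon_op_ge2 !(cmap0r cpsi) !addr0 => ->.
by rewrite [f _ + _]addrC.
Qed.

(** f_1 = L_0 f_2 + 2 R_1 f_1 - (L_1 + R_1 - 1) f_1, so L_0 f_2 and R_1 f_1
have to be reached. Modulo the solvable elements L_0 R_n u they are the values
of L_1 + R_1 - 1 at L_0 w and at R_1 f_1, where L_1 w = f_2 + R_2 f_1. *)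
Lemma cocycle_xx_solvable : solvable (f 1).
Proof.
(* Removing w' from f_2 cancels the term L_0 f_3 of L_1 f_2. *)
have [w' [Lw' _]] := lact1_solve (f 3).
pose w := f 2 - w'.
have Lw : L 1 w = f 2 + R 2 (f 1).
  by rewrite (cmapBr cl) cocycle_xx_ge2 Lw' addrAC addrK.
have sLR n u : solvable (L 0 (R n u)).
  by apply/solvable_lact0/right_unital_ract.
have sLf2 : solvable (L 0 (f 2)).
  rewrite -(addrK (L 0 (R 2 (f 1)) + L 0 (R 1 w)) (L 0 (f 2))).
  apply: solvableB; last exact: solvableD.
  exists (L 0 w); rewrite lact_lact0 Lw (cmapDr cl) ract_lact0 mulr1n /=.
  by rewrite addrAC addrK addrA.
have sRf1 : solvable (R 1 (f 1)).
  have : R 1 (R 1 (f 1)) = L 1 (R 1 (f 1)) - L 0 (R 2 (f 1)) - L 0 (R 1 (f 2)).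
    rewrite -ract_lact1 -ract_lact0 -(cmapBl cr).
    by rewrite cocycle_xx1 addrAC subrr add0r.
  rewrite ract1_ract => ->; apply: solvableB => //; apply: solvableB => //.
  by exists (R 1 (f 1)); rewrite ract1_ract addrK.
have -> : f 1 = L 0 (f 2) + R 1 (f 1) + R 1 (f 1) -
    (L 1 (f 1) + R 1 (f 1) - f 1).
  by rewrite cocycle_xx1 opprB addrC subrK.
by apply: solvableB; [apply: solvableD => //; exact: solvableD | exists (f 1)].
Qed.

(** If L_0 f_n = 0 then also L_1 f_n = 0, and the elements a_k = L_0^k f_(n+k)
satisfy L_1 a_k = (k+1) a_k + a_(k+1); hence L_1 a_k = 0 for all k, so a_(k+1)
is - (k+1) a_k. By locality a_k = 0 for large k, and therefore f_n = a_0 = 0.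
*)
Lemma cocycle_xx_eq0 : f 1 = 0 -> forall n, f n.+1 = 0.
Proof.
move=> f1; have Lf n : L 1 (f n.+2) = f n.+2 + L 0 (f n.+3).
  by rewrite cocycle_xx_ge2 f1 (cmap0l cr) addr0.
have Lf2 : L 0 (f 2) = 0.
  by have := cocycle_xx1; rewrite f1 (cmap0l cr) (cmap0r cl) addr0.
suff ker n : L 0 (f n.+2) = 0 -> f n.+2 = 0.
  case=> // n; elim: n => [|n IH]; first exact: ker.
  by apply: ker; have := Lf n; rewrite IH (cmap0r cl) add0r.
move=> Lfn0; pose a k := iter k (lact 0 x) (f (n + k).+2).
have La k : L 1 (a k) = a k *+ k.+1 + a k.+1.
  by rewrite /a addnS; exact: lact1_iter0 (Lf _).
have La0 k : L 1 (a k) = 0.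
  elim: k => [|k IH]; first by rewrite /a addn0 lact0_ker.
  have -> : a k.+1 = - (a k *+ k.+1).
    by apply/eqP; rewrite -addr_eq0 addrC -La IH.
  by rewrite (cmapNr cl) (cmapMnr cl) IH mul0rn oppr0.
suff /(_ 0%N) : forall k, a k = 0 by rewrite /a addn0.
elim/descending_ind => [|k ak].
  have [N fN] := cmap_locality cpsi x x; exists N => k le_Nk.
  rewrite /a fN; last by rewrite (leq_trans le_Nk) // -!addSn leq_addl.
  exact: iter_lact0_0.
apply: (@mulrSn_eq0 _ _ k _ charF0).
by have := La k; rewrite La0 ak addr0.
Qed.

(** psi_0(x,.) is H-linear, which settles psi_0(x,b). The identities at (n,0)
and (0,n) on (x,x,x^k) both express psi_n(x^2,x^k) and give psi_n(x,x^(k+1)) =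
0 from psi_n(x,x^k) = 0; finally x^(k+1) = x o_0 x^k carries the vanishing over
to the first argument. *)
Lemma cocycle_vanish :
  f 1 = 0 -> (forall k, psi 0 x (xmon F k) = 0) -> forall n a b, psi n a b = 0.
Proof.
move=> f1 psi0.
have psi0x b : psi 0 x b = 0.
  elim/cend1x_ind: b => [|b b' IH IH'|c b IH|b IH|//].
  - exact: cmap0r cpsi _ _.
  - by rewrite (cmapDr cpsi) IH IH' addr0.
  - by rewrite (cmapZr cpsi) IH scaler0.
  - by rewrite (cmap_Dr cpsi) IH mulr0n scaler0 addr0.
have fx n : f n = 0 by case: n => [|n]; [exact: psi0x | exact: cocycle_xx_eq0].
have psix n b : psi n x b = 0.
  elim/cend1x_ind: b n => [|b b' IH IH'|c b IH|b IH|k] n.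
  - exact: cmap0r cpsi _ _.
  - by rewrite (cmapDr cpsi) IH IH' addr0.
  - by rewrite (cmapZr cpsi) IH scaler0.
  - by rewrite (cmap_Dr cpsi) !IH mul0rn scaler0 addr0.
  elim: k n => [//|k IH] n.
  have : L n (psi 0 x (xmon F k)) + psi n x (cend1x_op 0 x (xmon F k)) =
      psi n (xmon F 1) (xmon F k) + psi n.-1 x (xmon F k) *+ n.
    rewrite cocycle_eq.
    under eq_bigr => s _ do rewrite fx (cmap0l cr) addr0 add0n.
    by rewrite (sum_xmon_op (g := fun s a => psi s a _)) // => s; exact: cmap0l.
  have := cocycle_at0 n x x (xmon F k).
  rewrite !IH fx !psi0x (cmap0r cl) (cmap0l cr) xmon_op0 !addr0 mul0rn => <-.
  by rewrite (cmap0r cl) add0r addr0 xmon_op0.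
move=> n a b; elim/cend1x_ind: a n => [|a a' IH IH'|c a IH|a IH|k] n.
- exact: cmap0l cpsi _ _.
- by rewrite (cmapDl cpsi) IH IH' addr0.
- by rewrite (cmapZl cpsi) IH scaler0.
- by rewrite (cmap_Dl cpsi) IH mul0rn oppr0.
elim: k n => [//|k IH] n.
have := cocycle_at0 n x (xmon F k) b.
by rewrite IH !psix (cmap0r cl) (cmap0l cr) xmon_op0 !addr0.
Qed.

End Cocycle.

End Bimodule.

Theorem theorem1 (F : fieldType) (charF0 : [pchar F] =i pred0)
    (M : lmodType {poly F})
    (lact : nat -> cend1x F -> M -> M) (ract : nat -> M -> cend1x F -> M)
    (HM : conformal_bimodule (@cend1x_op F) lact ract)
    (phi : nat -> cend1x F -> cend1x F -> M) :
  cocycle2 (@cend1x_op F) lact ract phi ->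
  coboundary2 (@cend1x_op F) lact ract phi.
Proof.
move=> [cphi phiK]; split=> //.
pose x := xmon F 0.
have [v vP] := cocycle_xx_solvable charF0 HM cphi phiK.
(* The recursion is the condition (phi - delta_1 tau)_0 (x, x^k) = 0. *)
pose t := fix t k := if k is j.+1
  then lact 0 x (t j) + ract 0 v (xmon F j) - phi 0 x (xmon F j) else v.
pose tau : {linear cend1x F -> M} := xmon_ext t.
have tauE k : tau (xmon F k) = t k := xmon_extE t k.
pose psi n a b := phi n a b - delta1 (@cend1x_op F) lact ract tau n a b.
have cpsi : conformal_map psi.
  exact: conformal_subdelta1 (cend1x_conformal F) HM _ _ cphi.
have psiK m n a b c : delta2 (@cend1x_op F) lact ract psi m n a b c = 0.
  by rewrite (delta2B HM) phiK (delta2_delta1 (cend1x_conformal F) HM) subr0.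
exists tau => n a b; apply/eqP; rewrite -subr_eq0; apply/eqP.
apply: (cocycle_vanish charF0 HM cpsi psiK) => [|k]; apply/eqP;
  rewrite subr_eq0 /delta1; apply/eqP.
  by rewrite xmon_op1 !tauE -vP addrAC.
by rewrite xmon_op0 !tauE /= [in RHS]addrAC opprB addrC subrK.
Qed.
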